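(* Let $f:\mathbb{R}^n\to\mathbb{R}$ be differentiable with $L$-Lipschitz continuous gradient for some $L>0$, and suppose $f_{\inf}:=\inf_{x\in\mathbb{R}^n} f(x)>-\infty$. Let $0\le\alpha\le 1$, $0<\theta<1$, $\rho>0$, $0<h\le 1/L$, $x_0\in\mathbb{R}^n$, and let $(x_k)$ be generated by the clipped iteration $$\rho_k=\min\left\{\rho,\ \frac{\theta}{L}\|\nabla f(x_k)\|^{\alpha}\right\},\qquad y_k=x_k+\rho_k\,\frac{\nabla f(x_k)}{\|\nabla f(x_k)\|^{\alpha}},\qquad x_{k+1}=x_k-h\nabla f(y_k).$$ Put $\Delta_0=f(x_0)-f_{\inf}$. Then for every $k\ge 0$, $$f(x_{k+1})\le f(x_k)-\frac h2(1-\theta^2)\|\nabla f(x_k)\|^2.$$ Consequently, for every integer $T\ge 1$, $$\min_{0\le k<T}\|\nabla f(x_k)\|\le\left(\frac{2\Delta_0}{h(1-\theta^2)T}\right)^{1/2},$$ and $\|\nabla f(x_k)\|\to 0$ as $k\to\infty$.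
   Context: $\|\cdot\|$ is the Euclidean norm on $\mathbb{R}^n$. Stopping convention: the method stops at $x_k$ if $\nabla f(x_k)=0$ (so the undefined normalized direction never occurs); in that case the sequence is understood to be constant from that index on, i.e. $x_j=x_k$ for all $j\ge k$. *)

(* Defs.v *)
From HB Require Import structures.
From mathcomp Require Export all_boot all_order all_algebra.
From mathcomp Require Export all_classical all_reals all_analysis.

Set Implicit Arguments.
Unset Strict Implicit.
Unset Printing Implicit Defensive.

Import Order.TTheory GRing.Theory Num.Theory.
Import numFieldNormedType.Exports.

Local Open Scope classical_set_scope.
Local Open Scope ring_scope.

(* The library norm [`|v|] on ['rV[R]_n] is the sup norm; it is only used here
   through the topology and the notion of differentiability it induces, which
   are the same as for the Euclidean norm. *)
Definition enorm (R : realType) (n : nat) (v : 'rV[R]_n) : R :=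
  Num.sqrt (\sum_(i < n) v 0 i ^+ 2).

Definition grad (R : realType) (n : nat) (f : 'rV[R]_n -> R) (x : 'rV[R]_n) :
    'rV[R]_n :=
  \row_(i < n) 'D_(delta_mx 0 i) f x.

Section clipped_iteration.
Variables (R : realType) (n : nat) (f : 'rV[R]_n -> R).
Variables (L alpha theta rho h : R).

Definition clipped_radius (x : 'rV[R]_n) : R :=
  Num.min rho (theta / L * enorm (grad f x) `^ alpha).

Definition clipped_probe (x : 'rV[R]_n) : 'rV[R]_n :=
  x + (clipped_radius x / enorm (grad f x) `^ alpha) *: grad f x.

(* At a stationary point the method stops. Since [x k.+1 = x k] is then again
   stationary, the sequence is constant from the first such index on. *)
Definition clipped_iteration (x0 : 'rV[R]_n) (x : nat -> 'rV[R]_n) : Prop :=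
  x 0%N = x0 /\
  forall k : nat,
    x k.+1 = if grad f (x k) == 0 then x k
             else x k - h *: grad f (clipped_probe (x k)).

End clipped_iteration.

(* Main.v *)
Require Import Defs.
From mathcomp Require Import all_boot all_order all_algebra.
From mathcomp Require Import all_classical all_reals all_analysis.
From mathcomp Require Import ring lra.

(** The probe point [y] sits at distance at most [(theta / L) |g|] from [x],
    where [g] is the gradient at [x]: the clipping only shortens the step, and
    the power [|g|^alpha] in the bound on the radius cancels the one in the
    normalisation.  Since the gradient is Lipschitz, the gradient [v] at the
    probe is then a relative approximation of the true one,
    [|v - g| <= theta |g|] ([probe_gradient_error]).

    A gradient step along any surrogate direction [v] with [h <= 1 / L] satisfies
    [f (x - h v) <= f x + h / 2 (|v - g|^2 - |g|^2)] ([inexact_gradient_step]):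
    this is the quadratic upper bound on a function with Lipschitz gradient
    ([descent_lemma]), in which the cross term [- h <g, v>] is polarised.  The
    two estimates together give the decrease of [f] in one step
    ([clipped_step_decrease]).

    The rest is about real sequences.  A nonnegative sequence [a] such that
    [c a_k^2] is bounded by the decrements of a sequence bounded below is square
    summable: averaging the telescoped sum bounds its running minimum
    ([bigmin_le_sqrt_of_decrease]), and the decrements of a convergent sequence
    tend to [0], so [a] does too ([cvg0_of_decrease]). *)

Import Order.TTheory GRing.Theory Num.Theory.
Import numFieldNormedType.Exports.

Local Open Scope classical_set_scope.
Local Open Scope ring_scope.

Set Implicit Arguments.
Unset Strict Implicit.

(** * Euclidean geometry of row vectors *)

Section euclidean.
Variables (R : realType) (n : nat).
Implicit Types (a b : 'rV[R]_n) (s : R).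

Definition edot a b : R := \sum_(i < n) a 0 i * b 0 i.

Lemma edotC a b : edot a b = edot b a.
Proof. by apply: eq_bigr => i _; rewrite mulrC. Qed.

Lemma edotDl a b c : edot (a + b) c = edot a c + edot b c.
Proof. by rewrite /edot -big_split; apply: eq_bigr => i _; rewrite mxE mulrDl. Qed.

Lemma edotZl s a b : edot (s *: a) b = s * edot a b.
Proof. by rewrite /edot mulr_sumr; apply: eq_bigr => i _; rewrite mxE mulrA. Qed.

Lemma edotBl a b c : edot (a - b) c = edot a c - edot b c.
Proof. by rewrite -scaleN1r edotDl edotZl mulN1r. Qed.

Lemma edotBr a b c : edot a (b - c) = edot a b - edot a c.
Proof. by rewrite edotC edotBl !(edotC a). Qed.

Lemma edotZr s a b : edot a (s *: b) = s * edot a b.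
Proof. by rewrite edotC edotZl edotC. Qed.

Lemma enorm_ge0 a : 0 <= enorm a.
Proof. exact: sqrtr_ge0. Qed.

Lemma enorm_sqr a : enorm a ^+ 2 = edot a a.
Proof.
rewrite sqr_sqrtr; last by apply: sumr_ge0 => i _; exact: sqr_ge0.
by apply: eq_bigr => i _; rewrite expr2.
Qed.

Lemma enormZ s a : 0 <= s -> enorm (s *: a) = s * enorm a.
Proof.
move=> s0; apply/eqP; rewrite -(@eqrXn2 _ 2) ?mulr_ge0 ?enorm_ge0//.
by rewrite exprMn !enorm_sqr edotZl edotZr mulrA expr2.
Qed.

Lemma enorm0 : enorm (0 : 'rV[R]_n) = 0.
Proof. by rewrite -(scale0r 0) enormZ// mul0r. Qed.

Lemma enorm_gt0 a : a != 0 -> 0 < enorm a.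
Proof.
move=> a0; rewrite lt_neqAle enorm_ge0 andbT eq_sym.
apply: contraNneq a0 => /(congr1 (fun r => r ^+ 2)).
rewrite enorm_sqr expr0n /= => /eqP; rewrite psumr_eq0 => [/allP a0|i _].
  apply/eqP/rowP => i; rewrite mxE; apply/eqP.
  by have := a0 i (mem_index_enum i); rewrite mulf_eq0 orbb.
by rewrite -expr2 sqr_ge0.
Qed.

Lemma enorm_sqrB a b :
  enorm (a - b) ^+ 2 = enorm a ^+ 2 - 2 * edot b a + enorm b ^+ 2.
Proof. by rewrite !enorm_sqr edotBl !edotBr (edotC a b); ring. Qed.

(** The scale [s] is built into the bound, so that expanding [|a - s b|^2]
    suffices and the general Cauchy-Schwarz inequality is avoided. *)
Lemma edot_le_scaled a b s :
  0 < s -> enorm a <= s * enorm b -> edot a b <= s * enorm b ^+ 2.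
Proof.
move=> s0 ab; rewrite -(ler_pM2l (_ : 0 < 2 * s)) ?mulr_gt0//.
have := sqr_ge0 (enorm (a - s *: b)); rewrite enorm_sqrB (enormZ _ (ltW s0)) edotZl.
have : enorm a ^+ 2 <= (s * enorm b) ^+ 2.
  by rewrite lerXn2r ?nnegrE ?mulr_ge0 ?enorm_ge0 ?(ltW s0).
rewrite (edotC b); lra.
Qed.

End euclidean.

(** * Functions with a Lipschitz gradient *)

Section lipschitz_gradient.
Variables (R : realType) (n : nat) (f : 'rV[R]_n -> R).
Hypothesis f_diff : forall u, differentiable f u.

Lemma diff_edot_grad u d : 'd f u d = edot (grad f u) d.
Proof.
rewrite {1}(row_sum_delta d) linear_sum; apply: eq_bigr => i _.
by rewrite linearZ /= mxE deriveE// mulrC.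
Qed.

Lemma is_derive_along_line u d (t : R) :
  is_derive t 1 (fun s : R => f (u + s *: d)) (edot (grad f (u + t *: d)) d).
Proof.
(* Both difference quotients are the same function of the increment. *)
have quotientE :
    (fun s : R => s^-1 *: (((fun s : R => f (u + s *: d)) \o shift t) (s *: (1 : R))
                           - f (u + t *: d)))
    = (fun s : R => s^-1 *: ((f \o shift (u + t *: d)) (s *: d) - f (u + t *: d))).
  apply/funext => s /=; congr (_ *: (f _ - _)).
  by rewrite [s *: 1]mulr1 scalerDl addrCA.
apply: DeriveDef.
  rewrite /derivable quotientE; exact: diff_derivable.
by rewrite /derive quotientE -diff_edot_grad -deriveE.
Qed.

Variable L : R.
Hypothesis L_gt0 : 0 < L.
Hypothesis grad_lip :
  forall u v, enorm (grad f u - grad f v) <= L * enorm (u - v).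

(** The mean value theorem applied on [[0, 1]] to
    [t |-> f (u + t d) - t <grad f u, d> - (L / 2) t^2 |d|^2], whose derivative
    [<grad f (u + t d) - grad f u, d> - L t |d|^2] is nonpositive because the
    gradient is [L]-Lipschitz. *)
Lemma descent_lemma u d :
  f (u + d) <= f u + edot (grad f u) d + L / 2 * enorm d ^+ 2.
Proof.
set A := edot (grad f u) d; set B := enorm d ^+ 2.
pose phi (t : R) := f (u + t *: d) - (A * t + L / 2 * B * t ^+ 2).
pose dphi (t : R) := edot (grad f (u + t *: d)) d - (A + L * B * t).
have phi_derive (t : R) : is_derive t (1 : R) phi (dphi t).
  have line := is_derive_along_line u d t.
  have -> : phi = (fun s : R => f (u + s *: d))
                  - (A \*: (@id R) + (L / 2 * B) \*: ((@id R) ^+ 2)).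
    by apply/funext => s.
  by apply: is_derive_eq; rewrite /dphi /GRing.scale /= expr1; field.
have [|c c01 phi_eq] := @MVT R phi dphi 0 1 ltr01 (fun t _ => phi_derive t).
  by apply: derivable_within_continuous => t _; case: (phi_derive t).
have c0 : 0 < c by move: c01; rewrite in_itv => /andP[].
have slope : edot (grad f (u + c *: d) - grad f u) d <= L * c * B.
  apply: edot_le_scaled; first exact: mulr_gt0.
  have := grad_lip (u + c *: d) u.
  by rewrite addrAC subrr add0r (enormZ _ (ltW c0)) mulrA.
move: phi_eq slope; rewrite edotBl -/A /phi /dphi scale1r scale0r addr0.
lra.
Qed.

(** With [h <= 1 / L] the quadratic term [(L / 2) h^2 |v|^2] of the descent
    lemma is at most [(h / 2) |v|^2], which completes [- h <g, v>] to the square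
    [(h / 2) |v - g|^2]. *)
Lemma inexact_gradient_step h u v : 0 < h -> h <= 1 / L ->
  f (u - h *: v) <=
    f u + h / 2 * (enorm (v - grad f u) ^+ 2 - enorm (grad f u) ^+ 2).
Proof.
move=> h0 hL; have := descent_lemma u (- (h *: v)).
rewrite -scaleNr edotZr enorm_sqrB [enorm (- h *: v) ^+ 2]enorm_sqr.
rewrite edotZl edotZr -enorm_sqr.
have : L * h ^+ 2 * enorm v ^+ 2 <= h * enorm v ^+ 2.
  rewrite ler_wpM2r ?sqr_ge0// expr2 mulrA ler_piMl ?(ltW h0)//.
  by move: hL; rewrite ler_pdivlMr// mulrC.
lra.
Qed.

(** * The decrease along the clipped iteration *)

Variables alpha theta rho h : R.
Hypotheses (theta_gt0 : 0 < theta) (rho_gt0 : 0 < rho).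

(** Dividing the radius by [|g|^alpha] leaves a coefficient at most [theta / L]
    in front of [g]; multiplying by the Lipschitz constant cancels [L]. *)
Lemma probe_gradient_error u : grad f u != 0 ->
  enorm (grad f (clipped_probe f L alpha theta rho u) - grad f u)
    <= theta * enorm (grad f u).
Proof.
move=> g0; have a0 := powR_gt0 alpha (enorm_gt0 g0).
apply: le_trans (grad_lip _ _) _.
rewrite /clipped_probe addrAC subrr add0r.
set r := clipped_radius _ _ _ _ _ _.
have r0 : 0 <= r.
  by rewrite /r /clipped_radius le_min !ltW//= mulr_gt0// divr_gt0.
have rle : r <= theta / L * enorm (grad f u) `^ alpha by rewrite ge_min lexx orbT.
rewrite enormZ; last by rewrite divr_ge0// ltW.
by rewrite mulrA ler_wpM2r ?enorm_ge0// mulrC -ler_pdivlMr// ler_pdivrMr.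
Qed.

Lemma clipped_step_decrease x0 x k : 0 < h -> h <= 1 / L ->
  clipped_iteration f L alpha theta rho h x0 x ->
  f (x k.+1) <= f (x k) - h / 2 * (1 - theta ^+ 2) * enorm (grad f (x k)) ^+ 2.
Proof.
move=> h0 hL [_ ->]; case: eqVneq => [->|g0].
  by rewrite enorm0 expr0n mulr0 subr0.
apply: le_trans (inexact_gradient_step _ _ h0 hL) _.
have err :
    enorm (grad f (clipped_probe f L alpha theta rho (x k)) - grad f (x k)) ^+ 2
    <= (theta * enorm (grad f (x k))) ^+ 2.
  rewrite lerXn2r ?nnegrE ?mulr_ge0 ?enorm_ge0 ?(ltW theta_gt0)//.
  exact: probe_gradient_error.
have h20 : 0 <= h / 2 by rewrite divr_ge0// ltW.
have := ler_wpM2l h20 err; rewrite exprMn; lra.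
Qed.

End lipschitz_gradient.

(** * Sequences controlled by a decreasing quantity *)

Section sufficient_decrease.
Variables (R : realType) (c m : R) (F a : nat -> R).
Hypotheses (c_gt0 : 0 < c) (a_ge0 : forall k, 0 <= a k).
Hypothesis F_ge : forall k, m <= F k.
Hypothesis F_decr : forall k, F k.+1 <= F k - c * a k ^+ 2.

Lemma sum_sqr_le_decrease T : c * \sum_(0 <= k < T) a k ^+ 2 <= F 0%N - F T.
Proof.
elim: T => [|T IH]; first by rewrite big_nil mulr0 subrr.
by rewrite big_nat_recr//= mulrDr; have := F_decr T; lra.
Qed.

(** The square of the minimum is at most the mean of the squares, which the
    total decrease [F 0 - m] bounds by telescoping. *)
Lemma bigmin_le_sqrt_of_decrease T : (1 <= T)%N ->
  \big[Num.min/a 0%N]_(0 <= k < T) a k <= Num.sqrt ((F 0%N - m) / (c * T%:R)).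
Proof.
move=> T1; set M := \big[_/_]_(_ <= _ < _) _.
have M0 : 0 <= M by apply: le_bigmin.
have M_le k : (k < T)%N -> M <= a k.
  by move=> kT; rewrite /M big_mkord; exact: (@bigmin_le _ _ _ _ (Ordinal kT)).
rewrite -(ger0_norm M0) -sqrtr_sqr ler_sqrt; last first.
  by rewrite divr_ge0 ?subr_ge0// mulr_ge0// ltW.
rewrite ler_pdivlMr ?mulr_gt0 ?ltr0n// mulrCA.
have : M ^+ 2 * T%:R <= \sum_(0 <= k < T) a k ^+ 2.
  rewrite big_mkord mulr_natr -[in M ^+ 2 *+ T](card_ord T) -sumr_const.
  by apply: ler_sum => i _; rewrite lerXn2r ?nnegrE ?M_le.
move=> /(ler_wpM2l (ltW c_gt0)) /le_trans; apply.
by apply: le_trans (sum_sqr_le_decrease T) _; rewrite lerB.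
Qed.

(** [F] is nonincreasing and bounded below, hence convergent, so the decrements
    squeeze [a_k^2] to [0]. *)
Lemma cvg0_of_decrease : a k @[k --> \oo] --> (0 : R).
Proof.
have F_cvg : cvgn F.
  apply: nonincreasing_is_cvgn.
    apply/nonincreasing_seqP => k; apply: le_trans (F_decr k) _.
    by rewrite gerBl mulr_ge0 ?sqr_ge0// ltW.
  by exists m => _ [k _ <-].
have decr_cvg : (c^-1 * (F k - F k.+1)) @[k --> \oo] --> (0 : R).
  rewrite -(mulr0 c^-1) -(subrr (limn F)); apply: cvgMr; apply: cvgB => //.
  by rewrite cvg_shiftS.
have sqr_cvg : a k ^+ 2 @[k --> \oo] --> (0 : R).
  apply: (@squeeze_cvgr _ _ _ _ (cst 0) (fun k => c^-1 * (F k - F k.+1))) => //.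
    near=> k; rewrite sqr_ge0 /= ler_pdivlMl//.
    by have := F_decr k; lra.
  exact: cvg_cst.
have -> : a = Num.sqrt \o (fun k => a k ^+ 2).
  by apply/funext => k /=; rewrite sqrtr_sqr ger0_norm.
rewrite -[X in _ --> X]sqrtr0.
by apply: continuous_cvg sqr_cvg; exact: sqrt_continuous.
Unshelve. all: by end_near. Qed.

End sufficient_decrease.

Unset Implicit Arguments.

Theorem theorem8 (R : realType) (n : nat) (f : 'rV[R]_n -> R)
    (L alpha theta rho h : R) (x0 : 'rV[R]_n) (x : nat -> 'rV[R]_n)
    (f_diff : forall u : 'rV[R]_n, differentiable f u)
    (L_gt0 : 0 < L)
    (grad_lip : forall u v : 'rV[R]_n,
       enorm (grad f u - grad f v) <= L * enorm (u - v))
    (f_bounded_below : has_lbound (range f))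
    (alpha_ge0 : 0 <= alpha) (alpha_le1 : alpha <= 1)
    (theta_gt0 : 0 < theta) (theta_lt1 : theta < 1)
    (rho_gt0 : 0 < rho)
    (h_gt0 : 0 < h) (h_leVL : h <= 1 / L)
    (x_iter : clipped_iteration f L alpha theta rho h x0 x) :
  let Delta0 := f x0 - inf (range f) in
  [/\ forall k : nat,
        f (x k.+1) <=
          f (x k) - h / 2 * (1 - theta ^+ 2) * enorm (grad f (x k)) ^+ 2,
      forall T : nat, (1 <= T)%N ->
        \big[Num.min/enorm (grad f (x 0%N))]_(0 <= k < T) enorm (grad f (x k))
          <= (2 * Delta0 / (h * (1 - theta ^+ 2) * T%:R)) `^ (1 / 2)
    & enorm (grad f (x k)) @[k --> \oo] --> (0 : R)].
Proof.
move=> Delta0; pose c := h / 2 * (1 - theta ^+ 2).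
have q_gt0 : 0 < 1 - theta ^+ 2 by rewrite subr_gt0 expr_lt1// ltW.
have c_gt0 : 0 < c by rewrite mulr_gt0// divr_gt0.
have decrease k : f (x k.+1) <= f (x k) - c * enorm (grad f (x k)) ^+ 2.
  exact: (clipped_step_decrease f_diff L_gt0 grad_lip theta_gt0 rho_gt0
            k h_gt0 h_leVL x_iter).
have f_ge k : inf (range f) <= f (x k).
  by apply: ge_inf => //; exists (x k).
have norm_ge0 k : 0 <= enorm (grad f (x k)) by exact: enorm_ge0.
split=> [//|T T1|]; last exact: cvg0_of_decrease c_gt0 norm_ge0 f_ge decrease.
have := bigmin_le_sqrt_of_decrease c_gt0 norm_ge0 f_ge decrease T1.
have [x_0 _] := x_iter.
have T_neq0 : T%:R != 0 :> R by rewrite pnatr_eq0 -lt0n.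
have -> : (f (x 0%N) - inf (range f)) / (c * T%:R)
          = 2 * Delta0 / (h * (1 - theta ^+ 2) * T%:R).
  by rewrite x_0 /c /Delta0; field; rewrite T_neq0 !gt_eqF.
rewrite div1r powR12_sqrt// divr_ge0//.
  by rewrite mulr_ge0// subr_ge0 -x_0.
by rewrite ltW// !mulr_gt0// ltr0n.
Qed.
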